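(* Let $b\ge 3$ be odd and let $O(b)$ be the set of odd integers $q$ with $1\le q\le b-1$ and $\gcd(q,b)=1$. The map $f(q)=|b-2q|$ is a permutation of $O(b)$. Let $(q_0,q_1,\dots,q_{p-1})$ be one of its cycles, listed in the order $q_j=f(q_{j-1})$, where $p=\mathrm{pes}(b)$ is the length of the cycle, and extend it periodically by $q_{t}=q_{t \bmod p}$. Put $S=q_0+q_1+\dots+q_{p-1}$. Consider the regular $(2b)$-gon with vertices labelled $0,1,\dots,2b-1$ counterclockwise. Start at the vertex labelled $0$ and at the $t$-th step ($t=0,1,2,\dots$) move counterclockwise by $q_t$ positions, i.e. along the diagonal joining the current vertex to the vertex $q_t$ positions further on. The resulting sequence of vertex labels is $v_0=0$, $v_n=\left(\sum_{t=0}^{n-1} q_t\right)\bmod 2b$ for $n\ge1$. Then: 1. The sequence $(v_n)_{n\ge 0}$ is purely periodic, so the trail is a closed, counterclockwise oriented Euler tour. 2. The primitive period of $(v_n)_{n\ge0}$ is $$L=\frac{2b\,\mathrm{pes}(b)}{\gcd(S,\,2b)}.$$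
   Context: The cycles of $f$ on $O(b)$ are the (unsigned) Schick cycles. In the paper they are obtained as follows. The first input is $q_0=1$. Each further input is the smallest element of $O(b)$ not yet contained in a previously generated cycle. All cycles have the same length, denoted $\mathrm{pes}(b)$. *)

(* Defs.v *)
From mathcomp Require Export all_boot all_order all_algebra.

Set Implicit Arguments.
Unset Strict Implicit.
Unset Printing Implicit Defensive.

Definition odd_units (b : nat) : seq nat :=
  [seq q <- iota 1 b.-1 | odd q & coprime q b].

Definition schick_map (b q : nat) : nat := `|b - 2 * q|%N.

Definition schick_cycle (b : nat) (c : seq nat) : Prop :=
  [/\ c != [::], {subset c <= odd_units b} & ufcycle (schick_map b) c].

(* The length of the cycle started at 1, i.e., the least k > 0 such that
   iter k (schick_map b) 1 = 1; for odd b >= 3 this k is at most size (odd_units b) < b, so the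
   search below succeeds. *)
Definition pes (b : nat) : nat :=
  (find (fun k => iter k.+1 (schick_map b) 1 == 1) (iota 0 b)).+1.

Definition cycle_term (c : seq nat) (t : nat) : nat := nth 0 c (t %% size c).

Definition trail (b : nat) (c : seq nat) (n : nat) : nat :=
  (\sum_(t < n) cycle_term c t) %% (2 * b).

Definition is_period (T : Type) (v : nat -> T) (P : nat) : Prop :=
  0 < P /\ forall n, v (n + P) = v n.

Definition purely_periodic (T : Type) (v : nat -> T) : Prop :=
  exists P, is_period v P.

Definition primitive_period (T : Type) (v : nat -> T) (L : nat) : Prop :=
  is_period v L /\ forall P, is_period v P -> L <= P.

(* {x, y} = {u, v} as unordered pairs. *)
Definition same_edge (T : Type) (x y u v : T) : Prop :=
  (x = u /\ y = v) \/ (x = v /\ y = u).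

(* E is the (symmetric) adjacency relation of an undirected simple graph; the
   tour is w 0, w 1, ..., w L. *)
Definition closed_euler_tour (T : Type) (E : T -> T -> Prop)
    (w : nat -> T) (L : nat) : Prop :=
  [/\ w L = w 0,
      forall n, n < L -> E (w n) (w n.+1)
    & forall x y, E x y ->
        exists! n, n < L /\ same_edge (w n) (w n.+1) x y].

(* The graph formed by all the edges traversed by the infinite walk w. *)
Definition walk_graph (T : Type) (w : nat -> T) (x y : T) : Prop :=
  exists n, same_edge (w n) (w n.+1) x y.

(* Vertices of the regular N-gon are labelled counterclockwise by 0, ..., N-1;
   a chord is run counterclockwise when its end is reached from its start by
   less than half a turn in the direction of increasing labels. *)
Definition counterclockwise (N : nat) (w : nat -> nat) : Prop :=
  forall n, exists d, [/\ 0 < d, 2 * d < N & w n.+1 = (w n + d) %% N].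

(* Main.v *)
Require Import Defs.
From mathcomp Require Import zify ring.

Set Implicit Arguments.
Unset Strict Implicit.
Unset Printing Implicit Defensive.

Import GRing.Theory.

(** Modulo [b] the map [schick_map b] is multiplication by [2] up to sign, and
    an element of [odd_units b] is determined by its class modulo [b] up to
    sign.  Hence its [k]-th iterate fixes an element exactly when
    [2 ^ k = +-1] modulo [b], a condition independent of the element, so that
    all the cycles have the same length [p].  The terms of a cycle are distinct
    and smaller than half of the [2b] vertices, so they can be recovered from
    the walk: its periods are the multiples [p * k] of [p] with [2b] dividing
    [k * S].  For the same reason an undirected edge determines the position
    in the cycle and the starting vertex, so an edge run twice yields a
    period. *)

Definition walk (N : nat) (u : nat -> nat) (n : nat) : nat :=
  (\sum_(t < n) u t) %% N.

(** * Closed walks on [N] vertices with [p]-periodic steps *)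

Section Walk.

Variables (N p : nat) (u : nat -> nat).
Hypothesis p_gt0 : 0 < p.
Hypothesis u_gt0 : forall t, 0 < u t.
Hypothesis u_lt : forall t, 2 * u t < N.
Hypothesis u_eq : forall s t, (u s == u t) = (s == t %[mod p]).

Let S := \sum_(t < p) u t.

Lemma walkS n : walk N u n.+1 = (walk N u n + u n) %% N.
Proof. by rewrite /walk big_ord_recr /= modnDml. Qed.

Lemma walk_inj_step m n :
  walk N u m = walk N u n -> walk N u m.+1 = walk N u n.+1 -> u m = u n.
Proof.
rewrite !walkS => -> /eqP; rewrite eqn_modDl => /eqP.
have := (u_lt m, u_lt n); case=> um un; rewrite !modn_small //; lia.
Qed.

Lemma walk_shift m n j : m = n %[mod p] -> walk N u m = walk N u n ->
  walk N u (m + j) = walk N u (n + j).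
Proof.
move=> mn wmn; elim: j => [|j IH]; first by rewrite !addn0.
rewrite !addnS !walkS IH; congr ((_ + _) %% _).
by apply/eqP; rewrite u_eq eqn_modDr mn.
Qed.

Lemma sum_periodic k : \sum_(t < p * k) u t = k * S.
Proof.
elim: k => [|k IH]; first by rewrite muln0 big_ord0.
rewrite mulnS addnC big_split_ord /= IH mulSn addnC; congr (_ + _).
by apply: eq_bigr => i _; apply/eqP; rewrite u_eq mulnC modnMDl.
Qed.

Lemma is_period_walk P :
  is_period (walk N u) P <->
  exists2 k, P = p * k & (0 < k) && (N %| k * S).
Proof.
split=> [[P_gt0 per]|[k -> /andP[k_gt0 Nk]]].
  (* Periodicity at [0] and [1] alone shows that step [P] repeats step [0], whence [p] divides
     [P]. *)
  have /eqP : u P = u 0.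
    by apply: walk_inj_step; [exact: (per 0) | exact: (per 1)].
  rewrite u_eq mod0n => /dvdnP[k Pk]; exists k; first by rewrite Pk mulnC.
  rewrite /dvdn -sum_periodic mulnC -Pk; apply/andP; split; first by lia.
  by have := per 0; rewrite /walk add0n big_ord0 mod0n => ->.
split=> [|n]; first by rewrite muln_gt0 p_gt0.
rewrite addnC -[in RHS](add0n n); apply: walk_shift.
  by rewrite mulnC modnMl mod0n.
by rewrite /walk sum_periodic big_ord0 mod0n; apply/eqP.
Qed.

Lemma primitive_period_walk : primitive_period (walk N u) ((N * p) %/ gcdn S N).
Proof.
have N_gt0 : 0 < N by have := u_lt 0; lia.
have g_gt0 : 0 < gcdn S N by rewrite gcdn_gt0 N_gt0 orbT.
have -> : (N * p) %/ gcdn S N = p * (N %/ gcdn S N).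
  by rewrite mulnC muln_divA // dvdn_gcdr.
have q_gt0 : 0 < N %/ gcdn S N by rewrite divn_gt0 // dvdn_leq // dvdn_gcdr.
(* Multiplied by the gcd, the right side says that [N] divides [gcdn (k * S) (k * N)], where the
   second entry is free. *)
have dvdE k : (N %| k * S) = (N %/ gcdn S N %| k).
  rewrite -[RHS](dvdn_pmul2r g_gt0) divnK ?dvdn_gcdr // muln_gcdr dvdn_gcd.
  by rewrite (dvdn_mull k (dvdnn N)) andbT.
split; first by apply/is_period_walk; exists (N %/ gcdn S N); rewrite ?dvdE ?q_gt0 /=.
move=> P /is_period_walk[k -> /andP[k_gt0]]; rewrite dvdE => Nk.
by rewrite leq_pmul2l // dvdn_leq.
Qed.

Lemma walk_same_edge m n x y : same_edge (walk N u m) (walk N u m.+1) x y ->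
  same_edge (walk N u n) (walk N u n.+1) x y ->
  walk N u m = walk N u n /\ u m = u n.
Proof.
have direct i j : walk N u i = walk N u j -> walk N u i.+1 = walk N u j.+1 ->
    walk N u i = walk N u j /\ u i = u j.
  by move=> ij Sij; split=> //; exact: walk_inj_step.
(* running an edge both ways would make two steps sum to a full turn *)
have opposite i j : walk N u i = walk N u j.+1 -> walk N u i.+1 = walk N u j ->
    False.
  move=> ij ji; have /eqP : walk N u j + (u j + u i) = walk N u j + 0 %[mod N].
    by rewrite addn0 addnA -modnDml -walkS -ij -walkS ji /walk modn_mod.
  have := (u_lt i, u_lt j); case=> ui uj.
  by rewrite eqn_modDl mod0n modn_small; have := u_gt0 i; lia.
case=> [[<- <-]|[<- <-]] [[e1 e2]|[e1 e2]].
- exact: direct.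
- by case: (@opposite m n).
- by case: (@opposite n m).
- exact: direct.
Qed.

Lemma walk_counterclockwise : counterclockwise N (walk N u).
Proof. by move=> n; exists (u n); split=> //; exact: walkS. Qed.

Lemma walk_closed_euler_tour L : primitive_period (walk N u) L ->
  closed_euler_tour (walk_graph (walk N u)) (walk N u) L.
Proof.
case=> -[L_gt0 per] min_L; split; first exact: (per 0).
  by move=> n _; exists n; left.
have perM k n : walk N u (n + k * L) = walk N u n.
  by elim: k => [|k IH]; rewrite ?addn0 // mulSnr addnA per.
have no_repeat m n : m < n -> n < L -> u m = u n ->
    walk N u m = walk N u n -> False.
  move=> mn nL /eqP; rewrite u_eq => /eqP mnp wmn.
  have: L <= n - m; last by lia.
  apply: min_L; split=> [|k]; first by lia.
  (* The two continuations agree only from [m] and [n] onwards; adding the period [L > m] brings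
     every [k] into that range. *)
  rewrite -(perM 1) mul1n -[RHS](perM 1) mul1n.
  have := walk_shift (k + L - m) mnp wmn.
  have -> : m + (k + L - m) = k + L by lia.
  by have -> : n + (k + L - m) = k + (n - m) + L by lia.
move=> x y [n nxy]; exists (n %% L).
have nL : n %% L < L by exact: ltn_pmod.
have n'xy : same_edge (walk N u (n %% L)) (walk N u (n %% L).+1) x y.
  have := perM (n %/ L) (n %% L); have := perM (n %/ L) (n %% L).+1.
  by rewrite addSn [_ %% _ + _]addnC -divn_eq => <- <-.
split=> // m [mL mxy].
have [w_eq u_nm] := walk_same_edge n'xy mxy.
case: (ltngtP (n %% L) m) => // lt_nm.
  by case: (no_repeat _ _ lt_nm).
by case: (no_repeat _ _ lt_nm).
Qed.

End Walk.

(** * Arithmetic of the Schick map modulo [b] *)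

Section SchickMap.

Variable b : nat.

Lemma mem_odd_units q :
  (q \in odd_units b) = [&& 0 < q, q < b, odd q & coprime q b].
Proof.
rewrite mem_filter mem_iota andbC; case: (odd q); case: (coprime q b) => //=;
  rewrite ?andbT ?andbF //; lia.
Qed.

Lemma one_odd_units : 1 < b -> 1 \in odd_units b.
Proof. by rewrite mem_odd_units coprime1n => ->. Qed.

Lemma schick_map_val q :
  schick_map b q = b - 2 * q + (2 * q - b).
Proof. rewrite /schick_map; lia. Qed.

Hypothesis b_odd : odd b.

Lemma schick_map_odd_units q : q \in odd_units b -> schick_map b q \in odd_units b.
Proof.
rewrite !mem_odd_units schick_map_val => /and4P[q_gt0 q_lt q_odd q_co].
have co2 : coprime (2 * q) b by rewrite coprimeMl q_co andbT coprime2n.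
have [le|lt] := leqP (2 * q) b.
  have [r bE] : exists r, b = 2 * q + r by exists (b - 2 * q); lia.
  have -> : b - 2 * q + (2 * q - b) = r by lia.
  have co : coprime r b.
    by move: co2; rewrite bE /coprime gcdnDl [2 * q + r]addnC gcdnDl gcdnC.
  by rewrite co andbT; lia.
have [r qE] : exists r, 2 * q = b + r by exists (2 * q - b); lia.
have -> : b - 2 * q + (2 * q - b) = r by lia.
have co : coprime r b by move: co2; rewrite qE coprime_sym /coprime gcdnDl gcdnC.
by rewrite co andbT; lia.
Qed.

(** Distinct [x] and [y] with equal images would satisfy [x + y = b], but [x + y] is even and [b] is
    odd. *)
Lemma schick_map_inj : {in odd_units b &, injective (schick_map b)}.
Proof.
move=> x y; rewrite !mem_odd_units !schick_map_val.
move=> /and4P[_ _ xo _] /and4P[_ _ yo _]; lia.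
Qed.

Lemma perm_schick_map :
  perm_eq [seq schick_map b q | q <- odd_units b] (odd_units b).
Proof.
have U : uniq (odd_units b) by rewrite filter_uniq ?iota_uniq.
have UM : uniq [seq schick_map b q | q <- odd_units b].
  by rewrite map_inj_in_uniq //; exact: schick_map_inj.
apply: uniq_perm => //.
have [|| _ //] := uniq_min_size UM (s2 := odd_units b).
  by move=> _ /mapP[q qO ->]; exact: schick_map_odd_units.
by rewrite size_map.
Qed.

Lemma iter_schick_map_odd_units k q :
  q \in odd_units b -> iter k (schick_map b) q \in odd_units b.
Proof. by move=> qO; elim: k => //= k; exact: schick_map_odd_units. Qed.

Lemma iter_schick_map_modz k q :
  exists e : bool, (b %|
    ((iter k (schick_map b) q)%:Z - (-1) ^+ e * (2 ^ k * q)%N%:Z)%R)%Z.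
Proof.
elim: k => [|k [e /dvdzP[r IH]]].
  by exists false; rewrite /= expr0 !mul1r mul1n subrr dvdz0.
set y := iter k _ _ in IH *; rewrite [iter _ _ _]/= -/y schick_map_val.
have -> : ((2 ^ k.+1 * q)%N%:Z = 2 * (2 ^ k * q)%N%:Z)%R by rewrite expnS; lia.
set z := ((2 ^ k * q)%N%:Z)%R in IH *.
have yE : (y%:Z = r * b%:Z + (-1) ^+ e * z)%R by rewrite -IH; ring.
have [le|lt] := leqP (2 * y) b.
  (* Here the new value is [b - 2 * y], so the sign flips; the witness comes from inserting [yE]. *)
  exists (~~ e); apply/dvdzP; exists (1 - 2 * r)%R.
  have -> : ((b - 2 * y + (2 * y - b))%N%:Z = b%:Z - 2 * y%:Z)%R by lia.
  by rewrite yE signrN; ring.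
exists e; apply/dvdzP; exists (2 * r - 1)%R.
have -> : ((b - 2 * y + (2 * y - b))%N%:Z = 2 * y%:Z - b%:Z)%R by lia.
by rewrite yE; ring.
Qed.

(** The sum [x + y] is even and lies strictly between [0] and [2 * b], so it is no multiple of the
    odd [b]; and [x - y] is smaller than [b] in absolute value. *)
Lemma eq_odd_units_modz x y : x \in odd_units b -> y \in odd_units b ->
  (exists e : bool, (b %| (x%:Z - (-1) ^+ e * y%:Z)%R)%Z) -> x = y.
Proof.
rewrite !mem_odd_units => /and4P[x_gt0 xb xo _] /and4P[y_gt0 yb yo _].
case=> -[]; rewrite ?expr0 ?expr1 ?mulN1r ?mul1r ?opprK => /dvdzP[r].
  by move=> E; have [|[]] : (r = 1 \/ r <= 0 \/ 2 <= r)%R; [lia | nia | nia | nia].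
by move=> E; have [|[]] : (r = 0 \/ r <= -1 \/ 1 <= r)%R; [lia | nia | nia | nia].
Qed.

(** The right side does not mention [q]: this is what makes all cycles equally long. Forwards, [q]
    is cancelled as a unit modulo [b]; backwards, a class up to sign determines its
    representative. *)
Lemma iter_schick_map_fixed k q : q \in odd_units b ->
  iter k (schick_map b) q = q <->
  exists e : bool, (b %| ((2 ^ k)%N%:Z - (-1) ^+ e)%R)%Z.
Proof.
move=> qO; have [d /dvdzP[r E]] := iter_schick_map_modz k q.
have signK (e : bool) : ((-1) ^+ e * (-1) ^+ e = 1 :> int)%R by case: e.
split=> [fixq|[e /dvdzP[s Es]]].
  exists d; have co : coprimez b q.
    by move: qO; rewrite mem_odd_units coprimezE /= coprime_sym => /and4P[].
  rewrite -(Gauss_dvdzl _ co); apply/dvdzP; exists (- (-1) ^+ d * r)%R.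
  move: E; rewrite fixq PoszM => E.
  rewrite -mulrA -E mulrBr !mulNr !mulrA signK; ring.
apply: eq_odd_units_modz => //; first exact: iter_schick_map_odd_units.
exists (d (+) e); apply/dvdzP; exists (r + (-1) ^+ d * s * q%:Z)%R.
rewrite signr_addb mulrDl -E PoszM.
have -> : ((-1) ^+ d * s * q%:Z * b%:Z = (-1) ^+ d * (s * b%:Z) * q%:Z)%R by ring.
by rewrite -Es; ring.
Qed.

End SchickMap.

(** * Return times on a cycle of a function *)

Section FunctionCycle.

Variables (T : eqType) (f : T -> T).

Lemma fcycle_traject x s : fcycle f (x :: s) ->
  x :: s = traject f x (size s).+1 /\ iter (size s).+1 f x = x.
Proof.
move=> /= /fpathP[n E].
have sz : n = (size s).+1 by rewrite -(size_rcons s x) E size_traject.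
have E' : rcons (x :: s) x = traject f x (size s).+2.
  by rewrite rcons_cons E sz.
move: E'; rewrite trajectSr => /rcons_inj[Es Ex].
by rewrite [in RHS]/= -Es -Ex.
Qed.

Lemma ufcycle_iter_eq x s k : ufcycle f (x :: s) ->
  (iter k f x == x) = (size (x :: s) %| k).
Proof.
move=> /andP[cyc un]; have [E fx] := fcycle_traject cyc.
have perM j : iter (j * (size s).+1) f x = x.
  by elim: j => // j IH; rewrite mulSn iterD IH.
rewrite /dvdn {1}(divn_eq k (size (x :: s))) addnC iterD perM.
have lt : k %% size (x :: s) < (size s).+1 by exact: ltn_pmod.
rewrite -(nth_traject f lt) -E.
(* As [x] is entry [0] of a duplicate-free list, equality of entries becomes
   [k %% size (x :: s) == 0]. *)
by rewrite -[X in _ == X]/(nth x (x :: s) 0) nth_uniq.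
Qed.

End FunctionCycle.

Lemma size_schick_cycle b c : 3 <= b -> odd b -> schick_cycle b c ->
  size c = pes b.
Proof.
move=> b3 b_odd [c0 cO cyc].
case: c c0 cO cyc => // x s _ cO cyc.
have xO : x \in odd_units b by apply: cO; rewrite mem_head.
have oneO := one_odd_units (ltnW b3).
(* The criterion independent of the starting point transfers the return times of [x] to [1], which
   need not lie on this cycle. *)
have fix1 k : (iter k (schick_map b) 1 == 1) = (size (x :: s) %| k).
  rewrite -(ufcycle_iter_eq k cyc); apply/eqP/eqP.
    by move/(iter_schick_map_fixed b_odd k oneO)/(iter_schick_map_fixed b_odd k xO).
  by move/(iter_schick_map_fixed b_odd k xO)/(iter_schick_map_fixed b_odd k oneO).
(* This puts index [size s], which stands for [size s + 1] iterations, inside the search range of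
   [pes]. *)
have s_lt : size s < b.
  have /(uniq_leq_size _) := cO; move/(_ (proj2 (andP cyc))) => /leq_trans; apply.
  by rewrite size_filter (leq_trans (count_size _ _)) // size_iota; lia.
rewrite /pes /=; congr _.+1.
set P := fun k => iter k.+1 (schick_map b) 1 == 1.
have PE k : P k = (size (x :: s) %| k.+1) by exact: fix1.
have hasP : has P (iota 0 b).
  by apply/hasP; exists (size s); rewrite ?mem_iota ?PE.
have lt_find : find P (iota 0 b) < b by rewrite -{2}(size_iota 0 b) -has_find.
have := nth_find 0 hasP; rewrite nth_iota // add0n PE => /dvdn_leq le.
apply/eqP; rewrite eqn_leq -ltnS le //= leqNgt; apply/negP => lt.
by have := before_find 0 lt; rewrite nth_iota // add0n PE dvdnn.
Qed.

Theorem theorem4 (b : nat) (b_ge3 : 3 <= b) (b_odd : odd b) :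
  perm_eq [seq schick_map b q | q <- odd_units b] (odd_units b) /\
  forall c : seq nat, schick_cycle b c ->
    [/\ size c = pes b,
        purely_periodic (trail b c) /\
        (forall L, primitive_period (trail b c) L ->
           closed_euler_tour (walk_graph (trail b c)) (trail b c) L /\
           counterclockwise (2 * b) (trail b c))
      & primitive_period (trail b c)
          ((2 * b * pes b) %/ gcdn (\sum_(q <- c) q) (2 * b))].
Proof.
split=> [|c cyc]; first exact: perm_schick_map.
have pesE := size_schick_cycle b_ge3 b_odd cyc.
have p_gt0 : 0 < size c by rewrite pesE.
case: cyc => _ cO /andP[_ c_uniq].
have uO t : cycle_term c t \in odd_units b.
  by apply/cO/mem_nth; rewrite ltn_mod.
have u_gt0 t : 0 < cycle_term c t.
  by have := uO t; rewrite mem_odd_units => /and4P[].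
have u_lt t : 2 * cycle_term c t < 2 * b.
  by have := uO t; rewrite mem_odd_units ltn_pmul2l // => /and4P[].
(* The entries of [c] are distinct, so a step reveals its index modulo [size c]. *)
have u_eq s t : (cycle_term c s == cycle_term c t) = (s == t %[mod size c]).
  by rewrite nth_uniq ?ltn_mod.
have sumE : \sum_(q <- c) q = \sum_(t < size c) cycle_term c t.
  rewrite (big_nth 0) big_mkord; apply: eq_bigr => i _.
  by rewrite /cycle_term modn_small.
(* The results on walks apply because [trail b c] is convertible to
   [walk (2 * b) (cycle_term c)]. *)
have prim := primitive_period_walk p_gt0 u_lt u_eq.
rewrite -sumE pesE in prim.
split=> //; split; first by case: prim => per _; eexists; exact: per.
move=> L primL; split; last exact: walk_counterclockwise u_gt0 u_lt.
exact: walk_closed_euler_tour u_gt0 u_lt u_eq _ primL.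
Qed.
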